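(* Let $T\in\mathbb T$ be a fixed tree. Then, uniformly for all degree statistics $\mathbf n=(n(i))_{i\ge0}$, with $\mathcal T_{\mathbf n}\sim\mathrm{Unif}(\mathbb T_{\mathbf n})$, $$\mathbb E N_T(\mathcal T_{\mathbf n})=|\mathbf n|\,\pi_{\mathbf p(\mathbf n)}(T)+O(1),$$ $$\mathrm{Var}\,N_T(\mathcal T_{\mathbf n})=|\mathbf n|\,\gamma_{\mathbf p(\mathbf n)}(T,T)+O(1).$$ More generally, if $T,T'\in\mathbb T$ are fixed, then, uniformly for all degree statistics $\mathbf n$, $$\mathrm{Cov}\bigl(N_T(\mathcal T_{\mathbf n}),N_{T'}(\mathcal T_{\mathbf n})\bigr)=|\mathbf n|\,\gamma_{\mathbf p(\mathbf n)}(T,T')+O(1).$$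
   Context: The implicit constants in $O(1)$ may depend on $T$ (and $T'$) but not on $\mathbf n$. $\mathbb N_0=\{0,1,2,\dots\}$. $\mathbb T$ is the set of all finite plane (i.e. ordered) rooted trees, up to isomorphism. For $T\in\mathbb T$, $|T|$ is its number of vertices and $n_T(i)$ is the number of vertices of $T$ with exactly $i$ children. A degree statistic is a sequence $\mathbf n=(n(i))_{i\ge0}$ of non-negative integers with $\sum_{i\ge0}n(i)=1+\sum_{i\ge0}i\,n(i)<\infty$; $|\mathbf n|:=\sum_{i\ge0}n(i)$; $\mathbf p(\mathbf n)=(p_i(\mathbf n))_{i\ge0}$ with $p_i(\mathbf n):=n(i)/|\mathbf n|$; $\mathbb T_{\mathbf n}$ is the set of $T\in\mathbb T$ with $n_T(i)=n(i)$ for all $i$; $\mathrm{Unif}(\mathbb T_{\mathbf n})$ is the uniform distribution on it. For a vertex $v$ of $T$, the fringe subtree $T_v\in\mathbb T$ consists of $v$ and all its descendants, rooted at $v$. $N_{T'}(T):=|\{v\in T: T_v=T'\}|$. For a probability distribution $\mathbf p=(p_i)_{i\ge0}$ on $\mathbb N_0$ with $\sum_i ip_i\le1$ and $T,T'\in\mathbb T$: $\pi_{\mathbf p}(T):=\prod_{i\ge0}p_i^{n_T(i)}$ (with $0^0:=1$), $$\eta_{\mathbf p}(T,T'):=(|T|-1)(|T'|-1)-\sum_{i\ge0}\frac{n_T(i)n_{T'}(i)}{p_i},$$ $$\gamma_{\mathbf p}(T,T):=\pi_{\mathbf p}(T)+\eta_{\mathbf p}(T,T)\,\pi_{\mathbf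 p}(T)^2,$$ $$\gamma_{\mathbf p}(T,T'):=N_{T'}(T)\pi_{\mathbf p}(T)+N_T(T')\pi_{\mathbf p}(T')+\eta_{\mathbf p}(T,T')\pi_{\mathbf p}(T)\pi_{\mathbf p}(T'),\qquad T\ne T',$$ with the conventions $0/0:=0$ and $0\cdot\infty:=0$. *)

(* Defs.v *)
From HB Require Import structures.
From mathcomp Require Import all_boot all_order all_algebra.
From mathcomp Require Import all_classical all_reals all_analysis.

Set Implicit Arguments.
Unset Strict Implicit.
Unset Printing Implicit Defensive.
Import Order.TTheory GRing.Theory Num.Theory.

Local Open Scope classical_set_scope.
Local Open Scope ring_scope.

(* A finite plane rooted tree is the ordered list of the subtrees hanging from
   the children of its root; isomorphic plane trees are equal. *)
Inductive plane_tree := Node of seq plane_tree.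

Definition children (t : plane_tree) : seq plane_tree := let: Node ts := t in ts.

Definition leaf : plane_tree := Node [::].

Fixpoint plane_tree_ind' (P : plane_tree -> Prop)
    (H : forall ts, (forall i, (i < size ts)%N -> P (nth leaf ts i)) -> P (Node ts))
    (t : plane_tree) : P t :=
  let: Node ts := t in
  H ts ((fix aux (s : seq plane_tree) :
           forall i, (i < size s)%N -> P (nth leaf s i) :=
    match s with
    | [::] => fun i (h : (i < 0)%N) => False_ind _ (notF h)
    | u :: s' => fun i =>
        match i return (i < size (u :: s'))%N -> P (nth leaf (u :: s') i) with
        | 0%N => fun=> plane_tree_ind' H u
        | j.+1 => aux s' j
        end
    end) ts).

Fixpoint tree_encode (t : plane_tree) : GenTree.tree unit :=
  let: Node ts := t in GenTree.Node 0 [seq tree_encode u | u <- ts].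

Fixpoint tree_decode (t : GenTree.tree unit) : plane_tree :=
  match t with
  | GenTree.Leaf _ => leaf
  | GenTree.Node _ ts => Node [seq tree_decode u | u <- ts]
  end.

Lemma tree_encodeK : cancel tree_encode tree_decode.
Proof.
elim/plane_tree_ind' => ts IH /=; congr Node; rewrite -map_comp.
apply: (@eq_from_nth _ leaf) => [|i]; rewrite size_map // => lti.
by rewrite (nth_map leaf) //=; exact: IH.
Qed.

HB.instance Definition _ := Countable.copy plane_tree (can_type tree_encodeK).
HB.instance Definition _ := isPointed.Build plane_tree leaf.
HB.instance Definition _ := @isMeasurable.Build default_measure_display
  plane_tree discrete_measurable discrete_measurable0
  discrete_measurableC discrete_measurableU.

(* Vertices are Ulam-Harris words: [::] is the root and i :: v is the vertex v
   of the subtree hanging from the i-th child of the root. *)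
Fixpoint vertices (t : plane_tree) : seq (seq nat) :=
  let: Node ts := t in
  [::] :: flatten [seq [seq ivs.1 :: v | v <- ivs.2]
                  | ivs <- zip (iota 0 (size ts)) [seq vertices u | u <- ts]].

(* The fringe subtree T_v; meaningful for v \in vertices t only. *)
Fixpoint fringe (t : plane_tree) (v : seq nat) : plane_tree :=
  if v is i :: w then fringe (nth leaf (children t) i) w else t.

Definition tree_size (t : plane_tree) : nat := size (vertices t).

(* n_T(i) *)
Definition outdeg_count (t : plane_tree) (i : nat) : nat :=
  count (fun v => size (children (fringe t v)) == i) (vertices t).

(* N_s(t): the number of vertices of t whose fringe subtree is s. *)
Definition fringe_count (s t : plane_tree) : nat :=
  count (fun v => fringe t v == s) (vertices t).

Definition nvertices (n : nat -> nat) : nat := \sum_(i \in [set: nat]) n i.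

(* The sums are finitely supported; for natural numbers, finiteness of
   \sum_i i * n i (equivalently of \sum_i n i) is finiteness of the support. *)
Definition degree_statistic (n : nat -> nat) : Prop :=
  finite_set [set i | n i != 0%N] /\
  nvertices n = (1 + \sum_(i \in [set: nat]) (i * n i))%N.

Definition trees_with (n : nat -> nat) : set plane_tree :=
  [set t | forall i, outdeg_count t i = n i].

Lemma measurable_trees_with (n : nat -> nat) : measurable (trees_with n).
Proof. by []. Qed.

(* The normalised counting measure of trees_with n. The last argument is only
   the value of mnormalize when trees_with n is empty or infinite, which does
   not happen for a degree statistic. *)
Definition unif_trees (R : realType) (n : nat -> nat) :
    probability plane_tree R :=
  mnormalize (mrestr (@counting plane_tree R) (measurable_trees_with n))
    (dirac leaf).

Section PiEtaGamma.
Context {R : realType}.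

(* The real-valued random variable N_s(t) of the random tree t. *)
Definition fringe_countR (s : plane_tree) : plane_tree -> R :=
  fun t => (fringe_count s t)%:R.

(* p(n) *)
Definition degree_distribution (n : nat -> nat) : nat -> R :=
  fun i => (n i)%:R / (nvertices n)%:R.

Implicit Types (p : nat -> R) (s t : plane_tree).

Definition tree_pi p t : R :=
  \big[*%R/1]_(i \in [set: nat]) p i ^+ outdeg_count t i.

(* Here x / 0 = 0. This agrees with the conventions 0 / 0 = 0 and 0 * oo = 0
   wherever tree_eta is used: if p i = 0 and the numerator is nonzero, then
   tree_pi p s = tree_pi p t = 0 and the product of all three vanishes. *)
Definition tree_eta p s t : R :=
  ((tree_size s)%:R - 1) * ((tree_size t)%:R - 1)
  - \sum_(i \in [set: nat]) (outdeg_count s i * outdeg_count t i)%:R / p i.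

Definition tree_gamma p s t : R :=
  if s == t then tree_pi p s + tree_eta p s s * tree_pi p s ^+ 2
  else (fringe_count t s)%:R * tree_pi p s + (fringe_count s t)%:R * tree_pi p t
       + tree_eta p s t * tree_pi p s * tree_pi p t.

End PiEtaGamma.

(* Main.v *)
Require Import Defs.
From HB Require Import structures.
From mathcomp Require Import all_boot all_order all_algebra.
From mathcomp Require Import all_classical all_reals all_analysis.
From mathcomp Require Import ring lra zify.

(** The sequence of the numbers of children of the vertices of a plane tree, in
    depth-first order, determines the tree, and no such word is a proper prefix
    of another one. Hence the vertices of [t] whose fringe subtree is [s] are
    the cyclic positions at which the word of [s] occurs in the word of [t]
    ([fringe_count_cyclic]): counting fringe subtrees is counting factors of a
    cyclic word.

    By the cycle lemma ([cycle_lemma], [is_forest_word_rot_eq0]) each arrangement of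
    a multiset [s] of numbers of children has exactly one rotation that is the
    word of a tree. As cyclic counts do not change under rotation, averaging
    over the trees with a given degree statistic is the same as averaging over
    all arrangements of [s] ([sum_trees_invariant]). A uniform arrangement is
    exchangeable, and begins with the word [u] with the probability [draw n N [::] u]
    of obtaining [u] in draws without replacement ([prefix_count_draw]).
    So, if [u] and [v] are the words of [t] and [t'], the mean of N_t is exactly
    N * draw u. In the second moment of (N_t, N_t') an occurrence of [u] and one
    of [v] are either nested, which yields the terms N_t'(t) and N_t(t') of
    gamma, or disjoint; there are N * (N + 1 - |u| - |v|) pairs of positions of
    the latter kind, and by exchangeability each of them contributes
    draw (u ++ v) ([prefix_count_disjoint], [trees_with_moments]).

    What remains is to compare draws without and with replacement, uniformly in
    the degree statistic. One factor of [draw] is the probability p_i up to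
    O(1/N), so draw u = pi(t) + O(1/N); that settles the mean and the nested
    terms. For the disjoint pairs one more order is needed: removing [u]
    beforehand moves a factor of draw v by (|u| p_i - n_u(i)) / N + O(1/N^2)
    ([Oinv_draw_factor_shift]). Telescoping over the letters of [v] and
    multiplying by pi(t) gives
    (|u| |v| - sum_i n_u(i) n_v(i) / p_i) pi(t) pi(t') / N ([draw_shiftE]), which
    with the correction 1 - |u| - |v| in the number of pairs is
    eta(t, t') pi(t) pi(t') / N ([Oinv_draw_cov]). *)

Set Implicit Arguments.
Unset Strict Implicit.
Unset Printing Implicit Defensive.
Import Order.TTheory GRing.Theory Num.Theory.

(** * Plane trees as words *)

Section Words.
Local Open Scope nat_scope.

Definition fringes (t : plane_tree) : seq plane_tree :=
  [seq fringe t v | v <- vertices t].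

Definition arity (t : plane_tree) : nat := size (children t).

Definition tree_word (t : plane_tree) : seq nat := [seq arity s | s <- fringes t].

Definition forest_word (ts : seq plane_tree) : seq nat :=
  flatten [seq tree_word t | t <- ts].

(** [vertices] lists the root first, then the vertices of each branch in turn. *)
Lemma fringesE ts :
  fringes (Node ts) = Node ts :: flatten [seq fringes t | t <- ts].
Proof.
rewrite /fringes /=; congr cons.
rewrite map_flatten -map_comp.
(* The children are numbered from [k] on, to make the induction go through. *)
have H : forall k us, (forall i, i < size us -> nth leaf ts (k + i) = nth leaf us i) ->
  flatten [seq [seq fringe (Node ts) (ivs.1 :: v) | v <- ivs.2]
    | ivs <- zip (iota k (size us)) [seq vertices u | u <- us]]
  = flatten [seq [seq fringe t v | v <- vertices t] | t <- us].
  move=> k us; elim: us k => [//|u us IH] k Hk /=.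
  rewrite IH; last by move=> i lti; rewrite addSnnS Hk.
  congr (_ ++ _); apply: eq_map => v /=.
  by move: (Hk 0 isT); rewrite addn0 /= => ->.
rewrite -(H 0 ts) //; congr flatten; apply: eq_map => -[i vs] /=.
by rewrite -map_comp.
Qed.

Lemma tree_wordE ts : tree_word (Node ts) = size ts :: forest_word ts.
Proof. by rewrite /tree_word fringesE /= map_flatten -map_comp. Qed.

Lemma forest_word_cons t ts : forest_word (t :: ts) = tree_word t ++ forest_word ts.
Proof. by []. Qed.

Lemma forest_word_cat ts us :
  forest_word (ts ++ us) = forest_word ts ++ forest_word us.
Proof. by rewrite /forest_word map_cat flatten_cat. Qed.

Lemma size_tree_word t : size (tree_word t) = tree_size t.
Proof. by rewrite !size_map. Qed.

Lemma size_fringes t : size (fringes t) = tree_size t.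
Proof. by rewrite size_map. Qed.

Lemma outdeg_countE t i : outdeg_count t i = count_mem i (tree_word t).
Proof. by rewrite /tree_word /fringes -map_comp count_map; apply: eq_count. Qed.

Lemma fringe_countE s t : fringe_count s t = count_mem s (fringes t).
Proof. by rewrite /fringes count_map; apply: eq_count. Qed.

(** The recognizer keeps the number [m] of trees still to be read: a letter [x]
    replaces one of them by the [x] branches of its root. *)
Fixpoint is_forest_word (m : nat) (w : seq nat) : bool :=
  match m, w with
  | m'.+1, x :: w' => is_forest_word (x + m') w'
  | _, _ => (m == 0) && (w == [::])
  end.

Lemma is_forest_word_cat m1 m2 w1 w2 :
  is_forest_word m1 w1 -> is_forest_word m2 w2 -> is_forest_word (m1 + m2) (w1 ++ w2).
Proof.
elim: w1 m1 => [|x w IH] [|m] //= H1 H2.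
by rewrite addnA; apply: IH.
Qed.

Lemma tree_is_forest_word t : is_forest_word 1 (tree_word t).
Proof.
elim/plane_tree_ind': t => ts IH; rewrite tree_wordE /= addn0.
elim: ts IH => [|t ts IHts] IH //.
rewrite forest_word_cons -[size _]/(1 + size ts)%N.
apply: is_forest_word_cat; first exact: (IH 0).
by apply: IHts => i lti; apply: (IH i.+1).
Qed.

Lemma forest_wordP m w :
  is_forest_word m w -> exists2 ts, size ts = m & forest_word ts = w.
Proof.
elim: w m => [|x w IH] [|m] //=; first by exists [::].
move/IH => [ts Hs <-].
exists (Node (take x ts) :: drop x ts).
  by rewrite /= size_drop Hs addKn.
rewrite forest_word_cons tree_wordE size_take Hs /=.
have -> : (if x < x + m then x else x + m) = x by case: ltnP; lia.
by rewrite -forest_word_cat cat_take_drop.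
Qed.

(** The first letter is the number of branches at the first root. Without it, and
    without that root, two forests with equally many trees are left, whose words
    are shorter by one letter. *)
Lemma forest_word_prefix_free ts us x y :
  size ts = size us -> forest_word ts ++ x = forest_word us ++ y -> ts = us.
Proof.
move: {2}(size (forest_word ts)) (leqnn (size (forest_word ts))) => n.
elim: n ts us x y => [|n IH] [|[ts1] ts] [|[us1] us] x y //.
rewrite !forest_word_cons !tree_wordE /= ltnS => le_n [eqs] [eqs1].
rewrite -!forest_word_cat => E.
have {IH E} E : ts1 ++ ts = us1 ++ us.
  apply: IH E; first by rewrite forest_word_cat.
  by rewrite !size_cat eqs1 eqs.
by move/eqP: E; rewrite eqseq_cat // => /andP[/eqP -> /eqP ->].
Qed.

Lemma tree_word_prefix_free s t w : prefix (tree_word s) w -> prefix (tree_word t) w -> s = t.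
Proof.
move=> /prefixP[x ->] /prefixP[y E].
have := @forest_word_prefix_free [:: s] [:: t] x y erefl.
by rewrite /forest_word /= !cats0 => /(_ E) [].
Qed.

Lemma tree_word_inj : injective tree_word.
Proof. by move=> s t E; apply: (@tree_word_prefix_free s t (tree_word s)); rewrite ?E prefix_refl. Qed.

(** Depth-first order visits a vertex and all of its descendants before it
    leaves its fringe subtree. *)
Lemma fringe_word_prefix t d : d < tree_size t ->
  prefix (tree_word (nth leaf (fringes t) d)) (drop d (tree_word t)).
Proof.
rewrite -size_fringes.
elim/plane_tree_ind': t d => ts IH [|d]; first by rewrite drop0 fringesE prefix_refl.
rewrite fringesE tree_wordE /=.
rewrite ltnS; elim: ts IH d => [//|t ts IHts] IH d.
rewrite forest_word_cons /= size_cat nth_cat drop_cat size_tree_word -size_fringes.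
move=> ltd; case: (ltnP d) => [ltd'|le].
  by apply: prefix_catl; apply: (IH 0).
apply: IHts; last by rewrite ltn_subLR.
by move=> i lti; apply: (IH i.+1).
Qed.

(** The suffix of the word of [t] at position [d] already begins with a complete
    tree word, which no other tree word can extend or shorten. This is why occurrences never overlap partially, and never wrap
    around the end of a cyclic word that starts as a tree word. *)
Lemma prefix_drop_tree_word s t d z : d < tree_size t ->
  prefix (tree_word s) (drop d (tree_word t) ++ z) = (nth leaf (fringes t) d == s).
Proof.
move=> /fringe_word_prefix Hp; apply/idP/eqP => [Hs|<-]; last exact: prefix_catl.
by apply: tree_word_prefix_free Hs; apply: prefix_catl.
Qed.

Lemma count_nth_sum (T : eqType) x0 (a : T) (s : seq T) :
  count_mem a s = \sum_(0 <= d < size s) (nth x0 s d == a).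
Proof. by rewrite -sum1_count big_mkcond (big_nth x0); apply: eq_bigr => d _ /=; case: eqP. Qed.

Definition cyclic_count (u w : seq nat) : nat :=
  \sum_(0 <= d < size w) prefix u (rot d w).

Lemma fringe_count_cyclic s t : fringe_count s t = cyclic_count (tree_word s) (tree_word t).
Proof.
rewrite fringe_countE (count_nth_sum leaf) /cyclic_count size_tree_word size_fringes.
apply: eq_big_nat => d /andP[_ ltd].
by rewrite /rot prefix_drop_tree_word.
Qed.

Lemma is_forest_wordN m w : is_forest_word m w -> sumn w + m = size w.
Proof. by elim: w m => [|x w IH] [|m] //= /IH; lia. Qed.

Lemma sumn_tree_word t : (sumn (tree_word t)).+1 = size (tree_word t).
Proof. by rewrite -(is_forest_wordN (tree_is_forest_word t)) addn1. Qed.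

(** As long as letters remain to be read, at least one tree is pending. *)
Lemma is_forest_word_sumn_prefix m (a b : seq nat) : b != [::] -> is_forest_word m (a ++ b) -> size a < sumn a + m.
Proof.
elim: a m => [|x a IH] [|m] //=; first by case: b.
move=> b0 /(IH _ b0); lia.
Qed.

(** Uniqueness in the cycle lemma: cut the word into [a ++ b] so that both
    [a ++ b] and [b ++ a] are tree words. Both pieces are then proper
    prefixes of a tree word, hence have letter sum at least their size, whereas
    the letter sum of the whole is one less than its size. *)
Lemma is_forest_word_rot_eq0 (w : seq nat) d : d < size w ->
  is_forest_word 1 w -> is_forest_word 1 (rot d w) -> d = 0.
Proof.
case: d => // d ltd Hw Hr; exfalso.
have H1 : drop d.+1 w != [::] by rewrite -size_eq0 size_drop subn_eq0 -ltnNge.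
have H2 : take d.+1 w != [::] by rewrite -size_eq0 size_takel // ltnW.
have := is_forest_word_sumn_prefix H2 Hr.
have := is_forest_wordN Hw.
have := Hw; rewrite -{1}(cat_take_drop d.+1 w) => /(is_forest_word_sumn_prefix H1).
rewrite -{3 4}(cat_take_drop d.+1 w) sumn_cat size_cat; lia.
Qed.

(** Reading [w] with [m.+1] pending trees either completes all of them somewhere, or
    keeps one pending all along; in the second case the equation on [k] says that
    [k] trees are pending at the end. *)
Lemma exhaust_or_survive m w :
  (exists a b, w = a ++ b /\ is_forest_word m.+1 a) \/
  (forall k v, k + size w = sumn w + m.+1 ->
     is_forest_word k v -> is_forest_word m.+1 (w ++ v)).
Proof.
elim: w m => [|x w IH] m; first by right=> k v; rewrite /= addn0 add0n => ->.
rewrite /=; case E: (x + m) => [|m'].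
  by left; exists [:: x], w; split => //=; rewrite E.
case: (IH m') => [[a [b [-> Ha]]]|H].
  by left; exists (x :: a), b; split => //=; rewrite E.
by right=> k v Hk; apply: H; lia.
Qed.

(** Read complete trees off [w] as long as possible; this gives the forest [a]. No
    prefix of the rest [b] is a complete tree, so that a reader of [b] with one
    pending tree never runs out of trees. The last clause expresses this through
    the words [v] that complete [b] to a tree word. *)
Lemma cycle_lemma_split w :
  exists a b m, [/\ w = a ++ b, is_forest_word m a &
    forall k v, k + size b = sumn b + 1 -> is_forest_word k v -> is_forest_word 1 (b ++ v)].
Proof.
move: {2}(size w) (leqnn (size w)) => n.
elim: n w => [|n IH] w.
  rewrite leqn0 size_eq0 => /eqP ->; exists [::], [::], 0; split => // k v /=.
  by rewrite addn0 => ->.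
move=> le; case: (exhaust_or_survive 0 w) => [[[|x a] [b [E Ha]]]//|H]; last first.
  by exists [::], w, 0; split.
have [|a' [b' [m [Eb Ha' Hb']]]] := IH b.
  by move: le; rewrite E /= size_cat; lia.
exists ((x :: a) ++ a'), b', (1 + m); split => //.
  by rewrite E Eb catA.
exact: is_forest_word_cat.
Qed.

(** Existence in the cycle lemma: with [w = a ++ b] as in the previous lemma, the
    count of pending trees after [b] is the number of trees in [a], so
    [b ++ a] is the word of one tree. *)
Lemma cycle_lemma w : (sumn w).+1 = size w ->
  exists t d, d < size w /\ w = rot d (tree_word t).
Proof.
move=> Ew; have [a [b [m [E Ha Hb]]]] := cycle_lemma_split w.
have Em := is_forest_wordN Ha.
move: Ew; rewrite E sumn_cat size_cat => Ew.
have /forest_wordP[[|t []] // _] : is_forest_word 1 (b ++ a) by apply: Hb Ha; lia.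
rewrite /forest_word /= cats0 => Et.
exists t; case: b => [|y b] in E Hb Ew Et *.
  by exists 0; split; [rewrite -Ew; lia|rewrite rot0 Et cats0].
case: a => [|x a] in E Ha Em Ew Et *.
  by exists 0; split; [rewrite -Ew; lia|rewrite rot0 Et cats0].
exists (size (y :: b)); split; first by rewrite /=; lia.
by rewrite Et rot_size_cat.
Qed.

End Words.

(** * Factors of the arrangements of a multiset *)

Section Arrangements.
Local Open Scope nat_scope.

Lemma sum_permutations_reindex (V : nmodType) (s : seq nat) (phi : seq nat -> seq nat)
    (f : seq nat -> V) :
  {in permutations s, forall w, perm_eq (phi w) w} ->
  {in permutations s &, injective phi} ->
  (\sum_(w <- permutations s) f (phi w) = \sum_(w <- permutations s) f w)%R.
Proof.
move=> phiP phiI; rewrite -(big_map phi predT f); apply: perm_big.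
have U : uniq (map phi (permutations s)).
  by rewrite map_inj_in_uniq // permutations_uniq.
apply: uniq_perm => //; first exact: permutations_uniq.
apply: (uniq_min_size U _ _).2; last by rewrite size_map.
move=> _ /mapP[w w_s ->]; rewrite mem_permutations.
by rewrite (perm_trans (phiP w w_s)) // -mem_permutations.
Qed.

Lemma sum_permutations_rot (V : nmodType) (s : seq nat) d (f : seq nat -> V) :
  (\sum_(w <- permutations s) f (rot d w) = \sum_(w <- permutations s) f w)%R.
Proof.
apply: sum_permutations_reindex => [w _|w w' _ _]; last exact: rot_inj.
by rewrite perm_rot.
Qed.

Lemma size_mem_permutations (s w : seq nat) : w \in permutations s -> size w = size s.
Proof. by rewrite mem_permutations => /perm_size. Qed.

Definition prefix_count (s u : seq nat) : nat := \sum_(w <- permutations s) prefix u w.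

Lemma prefix_count_eq0 (s u : seq nat) : size s < size u -> prefix_count s u = 0.
Proof.
move=> lt; apply: big1_seq => w /andP[_ /size_mem_permutations Ew].
by apply/eqP; rewrite eqb0; apply/negP => /size_prefix; rewrite Ew leqNgt lt.
Qed.

Lemma prefix_count_nil s : prefix_count s [::] = size (permutations s).
Proof. by rewrite /prefix_count -sum1_size; apply: eq_bigr => w _; rewrite prefix0s. Qed.

Lemma prefix_count_cons (s : seq nat) (i : nat) (u : seq nat) : i \in s ->
  prefix_count s (i :: u) = prefix_count (rem i s) u.
Proof.
move=> i_s; rewrite /prefix_count.
rewrite (eq_bigr (fun w => if prefix [:: i] w then (prefix u (behead w) : nat) else 0)); last first.
  by move=> [|x w] _ //; rewrite !prefix_cons prefix0s andbT; case: eqP.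
rewrite -big_mkcond -big_filter.
rewrite (perm_big [seq i :: w | w <- permutations (rem i s)]) /=; last first.
  apply: uniq_perm; first by rewrite filter_uniq // permutations_uniq.
    by rewrite map_inj_uniq ?permutations_uniq // => x y [].
  move=> w; rewrite mem_filter mem_permutations; apply/andP/mapP => [[]|[v]].
    case: w => // x w; rewrite prefix_cons prefix0s andbT => /eqP <- H.
    exists w => //; rewrite mem_permutations -(perm_cons i).
    by rewrite (perm_trans H) // perm_to_rem.
  rewrite mem_permutations => H ->; rewrite prefix_cons eqxx prefix0s; split => //.
  by rewrite perm_sym (perm_trans (perm_to_rem i_s)) // perm_cons perm_sym.
by rewrite big_map; apply: eq_bigr.
Qed.

Lemma prefix_rot1 (w : seq nat) i d : d < size w ->
  prefix [:: i] (rot d w) = (nth 0 w d == i).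
Proof.
by move=> ltd; rewrite /rot (drop_nth 0 ltd) /= prefix0s andbT eq_sym.
Qed.

(** Both sides count the pairs of an arrangement of [s] and a position where its
    letter is [i]; by rotation, all positions carry [i] equally often. *)
Lemma size_permutations_rem (s : seq nat) (i : nat) : i \in s ->
  size s * size (permutations (rem i s)) = count_mem i s * size (permutations s).
Proof.
move=> i_s; rewrite -prefix_count_nil -prefix_count_cons //.
transitivity (\sum_(w <- permutations s) count_mem i w); last first.
  rewrite (eq_big_seq (fun=> count_mem i s)); last first.
    by move=> w; rewrite mem_permutations => /permP ->.
  by rewrite big_const_seq count_predT iter_addn_0 mulnC.
under eq_big_seq => w w_s.
  rewrite (count_nth_sum 0) (size_mem_permutations w_s).
  under eq_big_nat => d /andP[_ ltd].
    rewrite -prefix_rot1 ?(size_mem_permutations w_s) //; over.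
  over.
rewrite exchange_big /=.
under eq_bigr do rewrite (sum_permutations_rot s _ (fun w => prefix [:: i] w : nat)).
by rewrite sum_nat_const_nat subn0.
Qed.

Lemma cyclic_count_rot u w d : cyclic_count u (rot d w) = cyclic_count u w.
Proof.
elim: d => [|d IH]; first by rewrite rot0.
case: (ltnP d (size w)) => [ltd|le]; last by rewrite rot_oversize // (leq_trans le).
rewrite rotS // -{}IH; move: (rot d w) => {w d ltd} w.
rewrite /cyclic_count size_rot; case: w => [|x w]; first by rewrite big_nil.
rewrite big_nat_recr // big_nat_recl // rot0 [LHS]addnC; congr (_ + _).
  by rewrite rot_rot -rotS // -[(size w).+1]/(size (x :: w)) rot_size.
by apply: eq_big_nat => e /andP[_ lte]; rewrite rot_rot -rotS // ltnS ltnW.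
Qed.

Lemma sum_cyclic_count s u :
  \sum_(w <- permutations s) cyclic_count u w = size s * prefix_count s u.
Proof.
under eq_big_seq => w w_s do rewrite /cyclic_count (size_mem_permutations w_s).
rewrite exchange_big /=.
under eq_bigr do rewrite (sum_permutations_rot s _ (fun w => prefix u w : nat)).
by rewrite sum_nat_const_nat subn0.
Qed.

(** Rotating the word so that the occurrence of [u] starts it does not change the
    cyclic count of [v]. *)
Lemma sum_cyclic_countM s u v :
  \sum_(w <- permutations s) cyclic_count u w * cyclic_count v w =
  size s * \sum_(w <- permutations s) prefix u w * cyclic_count v w.
Proof.
under eq_big_seq => w w_s.
  rewrite {1}/cyclic_count (size_mem_permutations w_s) big_distrl /=.
  under eq_bigr => d _ do rewrite -(cyclic_count_rot v w d).
  over.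
rewrite exchange_big /=.
under eq_bigr do rewrite (sum_permutations_rot s _ (fun w => prefix u w * cyclic_count v w)).
by rewrite sum_nat_const_nat subn0.
Qed.

(** The occurrences of the word of [t] that start inside an initial word of [s]
    are those of the fringe subtrees of [s]. *)
Lemma sum_prefix_nested s t w : prefix (tree_word s) w ->
  \sum_(0 <= d < tree_size s) prefix (tree_word t) (rot d w) = fringe_count t s.
Proof.
move=> /prefixP[z ->]; rewrite fringe_countE (count_nth_sum leaf) size_fringes.
apply: eq_big_nat => d /andP[_ ltd].
rewrite /rot drop_cat size_tree_word ltd -catA prefix_drop_tree_word //.
Qed.

(** Exchangeability: [phi] keeps the first [size u] letters and rotates the others so
    that those from position [d] on follow immediately. *)
Lemma prefix_count_disjoint (s u v : seq nat) d : size u <= d -> d + size v <= size s ->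
  \sum_(w <- permutations s) prefix u w * prefix v (rot d w) = prefix_count s (u ++ v).
Proof.
move=> le_ud le_ds.
pose phi (w : seq nat) := take (size u) w ++ rot (d - size u) (drop (size u) w).
have szt w : w \in permutations s -> size (take (size u) w) = size u.
  move=> /size_mem_permutations Ew; rewrite size_takel // Ew.
  exact: leq_trans le_ud (leq_trans (leq_addr _ _) le_ds).
rewrite /prefix_count -(@sum_permutations_reindex _ s phi (fun w => prefix (u ++ v) w : nat)).
- apply: eq_big_seq => w w_s; have Ew := size_mem_permutations w_s.
  rewrite mulnb; congr (nat_of_bool _).
  have [/prefixP[r Ewr]|Np] /= := boolP (prefix u w).
    rewrite /phi Ewr take_size_cat // drop_size_cat //.
    have Er : size r = size s - size u by rewrite -Ew Ewr size_cat addKn.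
    have -> : prefix (u ++ v) (u ++ rot (d - size u) r) = prefix v (rot (d - size u) r).
      by rewrite prefix_catr // eqxx.
    have szv : size v <= size (drop (d - size u) r) by rewrite size_drop Er; lia.
    by rewrite /rot drop_cat ltnNge le_ud /= !prefixE !(takel_cat _ szv).
  apply/esym/negbTE; apply: contra Np => /catl_prefix.
  by rewrite !prefixE take_cat szt // ltnn subnn take0 cats0.
- move=> w _; rewrite -[X in perm_eq _ X](cat_take_drop (size u)) perm_cat2l.
  by rewrite perm_rot.
- move=> w w' w_s w'_s /eqP; rewrite eqseq_cat ?szt // eqseq_rot => /andP[/eqP E1 /eqP E2].
  by rewrite -(cat_take_drop (size u) w) E1 E2 cat_take_drop.
Qed.

(** An occurrence of [t'] that wraps around to the beginning of the word
    contains the initial [t] at its position [x]; rotate [t'] to the front. *)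
Lemma prefix_count_wrapped s t t' x : 0 < x -> x < tree_size t' -> x <= size s ->
  \sum_(w <- permutations s) prefix (tree_word t) w * prefix (tree_word t') (rot (size s - x) w)
  = (nth leaf (fringes t') x == t) * prefix_count s (tree_word t').
Proof.
move=> x0 ltx lex.
rewrite -(sum_permutations_rot s x) /prefix_count big_distrr /=.
apply: eq_big_seq => w w_s; have Ew := size_mem_permutations w_s.
have -> : rot (size s - x) (rot x w) = w.
  by rewrite -Ew -{1}(size_rot x w) -/(rotr x _) rotK.
rewrite mulnC [RHS]mulnC.
have [/prefixP[r ->]|] := boolP (prefix (tree_word t') w); last by rewrite !mul0n.
by rewrite /rot drop_cat size_tree_word ltx -catA prefix_drop_tree_word.
Qed.

(** Occurrences of [t'] that start behind the initial [t] either end before the word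
    does, or wrap around and then contain [t]. The term [t == t'] removes the
    occurrence of [t] at the root of [t'], which starts at position 0 and is
    nested in [t] as well. The truncated subtraction is harmless: when it
    vanishes, the words of [t] and [t'] do not fit together into the word. *)
Lemma sum_prefix_apart s t t' :
  \sum_(tree_size t <= d < size s)
    \sum_(w <- permutations s) prefix (tree_word t) w * prefix (tree_word t') (rot d w)
  = ((size s).+1 - (tree_size t + tree_size t')) * prefix_count s (tree_word t ++ tree_word t')
    + (fringe_count t t' - (t == t')) * prefix_count s (tree_word t').
Proof.
set k := tree_size t; set k' := tree_size t'; set N := size s.
set S2 := prefix_count s _; set f := BIG_F.
pose g x := (nth leaf (fringes t') x == t) * prefix_count s (tree_word t').
have k'0 : 0 < k' by rewrite /k' -size_tree_word -sumn_tree_word.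
(* If [t] is the fringe subtree of [t'] at [x], then [x + k <= k'], while [k' <= N] if
   the word of [t'] occurs at all. *)
have g0 x : x < k' -> N < x + k -> g x = 0.
  move=> ltx ltN; rewrite /g; case: eqP => [Et|]; last by rewrite mul0n.
  rewrite prefix_count_eq0 ?muln0 // size_tree_word -/k' -/N.
  have /size_prefix := fringe_word_prefix ltx.
  by rewrite Et size_drop !size_tree_word -/k -/k'; lia.
have -> : (fringe_count t t' - (t == t')) * prefix_count s (tree_word t') = \sum_(1 <= x < k') g x.
  rewrite -big_distrl /= fringe_countE (count_nth_sum leaf) size_fringes -/k'.
  rewrite big_ltn //; case: (t') => ts.
  by rewrite {1}fringesE /= eq_sym addKn.
case: (ltnP N k) => [ltN|leN].
  rewrite big_geq 1?ltnW // (_ : N.+1 - _ = 0); last by lia.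
  by apply/esym; rewrite big_nat big1 // => x /andP[_ ltx]; rewrite g0 //; lia.
(* [x] is the distance from the start of [t'] to the end of the word. *)
transitivity (\sum_(1 <= x < (N - k).+1) f (N - x)).
  rewrite -{1}[k]add0n big_addn big_nat_rev big_add1 /=.
  by apply: eq_big_nat => i /andP[_ lti]; congr (f _); lia.
rewrite (bigID (fun x => k' <= x)) /=; congr (_ + _).
  transitivity (\sum_(k' <= x < (N - k).+1) S2).
    rewrite [RHS](big_nat_widenl _ 1) //=; apply: congr_big_nat => // x /andP[lex /andP[_ ltx]].
    rewrite /f prefix_count_disjoint // ?size_tree_word -/k -/k' -/N; lia.
  by rewrite sum_nat_const_nat; congr (_ * _); lia.
transitivity (\sum_(1 <= x < (N - k).+1 | x < k') g x).
  rewrite [RHS]big_nat_cond [LHS]big_nat_cond.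
  apply: eq_big => x; rewrite -?ltnNge //= => /andP[/andP[x0 ltx] ltk].
  by rewrite /f prefix_count_wrapped -/N -/k' //; lia.
(* Both sides sum over the [x] below [k'] and below [(N - k).+1]; [M] bounds both. *)
pose M := (N - k).+1 + k'.
rewrite (big_nat_widen _ _ M); last by rewrite /M; lia.
rewrite [RHS](big_nat_widen _ _ M); last by rewrite /M; lia.
rewrite [LHS]big_mkcond [RHS]big_mkcond.
apply: eq_bigr => x _ /=; case: (ltnP x k') => //= ltx; case: ltnP => // leN'.
by rewrite g0 //; lia.
Qed.

(** The three terms count the occurrences of [t'] that are nested in the initial [t],
    disjoint from it, and around it. *)
Lemma sum_prefix_cyclic_count s t t' :
  \sum_(w <- permutations s) prefix (tree_word t) w * cyclic_count (tree_word t') w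
  = fringe_count t' t * prefix_count s (tree_word t)
    + ((size s).+1 - (tree_size t + tree_size t')) * prefix_count s (tree_word t ++ tree_word t')
    + (fringe_count t t' - (t == t')) * prefix_count s (tree_word t').
Proof.
rewrite -addnA -sum_prefix_apart.
case: (ltnP (size s) (tree_size t)) => [lt|le].
  rewrite prefix_count_eq0 ?size_tree_word // muln0 big_geq 1?ltnW //.
  apply: big1_seq => w /andP[_ /size_mem_permutations Ew].
  have [/size_prefix|//] := boolP (prefix _ w).
  by rewrite size_tree_word Ew leqNgt lt.
under eq_big_seq => w w_s.
  rewrite /cyclic_count (size_mem_permutations w_s) big_distrr /=; over.
rewrite exchange_big /= (big_cat_nat _ le) //=; congr (_ + _).
rewrite exchange_big /prefix_count big_distrr /=; apply: eq_bigr => w _.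
rewrite -big_distrr /= mulnC.
by have [/sum_prefix_nested -> //|_] := boolP (prefix _ w); rewrite !muln0.
Qed.

Lemma fringe_count_self t : fringe_count t t = 1.
Proof.
rewrite fringe_countE (count_nth_sum leaf) size_fringes.
have t0 : 0 < tree_size t by rewrite -size_tree_word -sumn_tree_word.
rewrite big_ltn //; case: (t) => ts; rewrite {1}fringesE eqxx.
rewrite big_nat big1 ?addn0 // => d /andP[d0 ltd]; case: eqP => // E.
by have /size_prefix := fringe_word_prefix ltd; rewrite E size_drop size_tree_word; lia.
Qed.

(** The cycle lemma as a bijection: pairs of a tree and a rotation correspond to
    arrangements of [s]. *)
Lemma sum_permutations_trees (s : seq nat) (L : seq plane_tree) (f : seq nat -> nat) :
  (sumn s).+1 = size s -> uniq L -> (forall t, (t \in L) = perm_eq (tree_word t) s) ->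
  (\sum_(w <- permutations s) f w
  = \sum_(t <- L) \sum_(d <- iota 0 (size s)) f (rot d (tree_word t)))%N.
Proof.
move=> Hs uL memL.
rewrite -(@big_allpairs_dep _ _ _ _ _ _ (fun t d => rot d (tree_word t)) L (fun=> iota 0 (size s)) f).
apply: perm_big; apply: uniq_perm; first exact: permutations_uniq.
  apply: allpairs_uniq => //; first exact: iota_uniq.
  (* Equal rotations by [d <= d'] make a tree word a rotation by [d' - d] of another. *)
  have aux t d t' d' : t \in L -> t' \in L -> (d <= d' < size s)%N ->
      rot d (tree_word t) = rot d' (tree_word t') -> (t, d) = (t', d').
    rewrite !memL => /perm_size Et /perm_size Et' /andP[le_d lt_d'].
    rewrite -{1}(subnKC le_d) rotD; last by rewrite subnKC // Et' ltnW.
    move/rot_inj => E.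
    have lt_dd : (d' - d < size (tree_word t'))%N by rewrite Et' (leq_ltn_trans (leq_subr _ _)).
    have /(is_forest_word_rot_eq0 lt_dd (tree_is_forest_word t')) E0 : is_forest_word 1 (rot (d' - d) (tree_word t')).
      by rewrite -E tree_is_forest_word.
    move: E; rewrite E0 rot0 => /tree_word_inj ->; congr pair; lia.
  move=> _ _ /allpairsP[[t d] /= [tL dN ->]] /allpairsP[[t' d'] /= [tL' dN' ->]] /= E.
  move: dN dN' E; rewrite !mem_iota /= !add0n => dN dN' E.
  case: (leqP d d') => le_d; first exact: (aux _ _ _ _ tL tL' (introT andP (conj le_d dN')) E).
  exact/esym/(aux _ _ _ _ tL' tL (introT andP (conj (ltnW le_d) dN)) (esym E)).
move=> w; rewrite mem_permutations; apply/idP/allpairsP => [Hw|[[t d] /= [tL _ ->]]]; last first.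
  by rewrite perm_rot -memL.
have [|t [d [ltd Ew]]] := @cycle_lemma w; first by rewrite (perm_sumn Hw) (perm_size Hw).
exists (t, d); split => //=; last by rewrite mem_iota /= add0n -(perm_size Hw).
by rewrite memL -(perm_rot d) -Ew.
Qed.

(** Each tree accounts for [size s] arrangements, its rotations, and [f] is constant on
    them. *)
Lemma sum_trees_invariant (s : seq nat) (L : seq plane_tree) (f : seq nat -> nat) K :
  (sumn s).+1 = size s -> uniq L -> (forall t, (t \in L) = perm_eq (tree_word t) s) ->
  (forall d w, f (rot d w) = f w) ->
  (\sum_(w <- permutations s) f w = size s * K)%N -> (\sum_(t <- L) f (tree_word t) = K)%N.
Proof.
move=> sum_s uL memL f_rot; rewrite (sum_permutations_trees f sum_s uL memL).
rewrite [X in X = (size s * K)%N -> _](eq_bigr (fun t => size s * f (tree_word t))%N); last first.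
  move=> t _; under eq_bigr do rewrite f_rot.
  by rewrite big_const_seq count_predT size_iota iter_addn_0 mulnC.
rewrite -big_distrr /= => /eqP; rewrite eqn_pmul2l; first by move/eqP.
by rewrite -sum_s.
Qed.

End Arrangements.

Section Draw.
Local Open Scope ring_scope.
Context {R : realType}.

Definition draw_factor (n : nat -> nat) (N : nat) (r : seq nat) (i : nat) : R :=
  ((n i)%:R - (count_mem i r)%:R) / (N%:R - (size r)%:R).

(** The probability that draws without replacement from an urn with [n i] balls
    labelled [i], [N] in all, yield [u] after they have yielded [r]. The factors need no
    truncation at 0: if [r] can be drawn, a negative factor is preceded by a zero one. *)
Fixpoint draw (n : nat -> nat) (N : nat) (r u : seq nat) : R :=
  if u is i :: v then draw_factor n N r i * draw n N (rcons r i) v else 1.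

Lemma draw_cat n N r u v : draw n N r (u ++ v) = draw n N r u * draw n N (r ++ u) v.
Proof.
elim: u r => [|i u IH] r /=; first by rewrite mul1r cats0.
by rewrite IH mulrA cat_rcons.
Qed.

(** The fraction of the arrangements of [s] that begin with [i] is the multiplicity of [i] over the size
    of [s] ([size_permutations_rem]), and what follows [i] is an arbitrary arrangement of the
    remaining letters. The list [r] records the letters removed so far. *)
Lemma prefix_count_draw n N (s r u : seq nat) :
  (forall i, n i = count_mem i s + count_mem i r)%N -> N = (size s + size r)%N ->
  (prefix_count s u)%:R = (size (permutations s))%:R * draw n N r u.
Proof.
elim: u s r => [|i u IH] s r Hn HN /=; first by rewrite prefix_count_nil mulr1.
have -> : draw_factor n N r i = (count_mem i s)%:R / (size s)%:R.
  by rewrite /draw_factor Hn HN !natrD !addrK.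
have [i_s|i_s] := boolP (i \in s); last first.
  rewrite (count_memPn i_s) mul0r mul0r mulr0 /prefix_count big1_seq // => w /andP[_ w_s].
  case: prefixP => // -[z Ew]; move: w_s i_s.
  by rewrite mem_permutations Ew => /perm_mem <-; rewrite mem_head.
have s0 : (size s)%:R != 0 :> R by rewrite pnatr_eq0; case: (s) i_s.
have Es := perm_to_rem i_s.
rewrite prefix_count_cons // (IH (rem i s) (rcons r i)); last 2 first.
- move=> j; rewrite Hn (permP Es) /= -cats1 count_cat /=; lia.
- by rewrite HN (perm_size Es) /= size_rcons; lia.
have := congr1 (fun k => k%:R : R) (size_permutations_rem i_s).
rewrite /= !natrM => E.
have -> : (size (permutations (rem i s)))%:R
    = (count_mem i s)%:R * (size (permutations s))%:R / (size s)%:R :> R.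
  by rewrite -E mulrAC mulfV // mul1r.
ring.
Qed.

Lemma size_permutations_gt0 (s : seq nat) : (0 < size (permutations s))%N.
Proof. by rewrite -has_predT; apply/hasP; exists s; rewrite ?mem_permutations. Qed.

End Draw.

(** * Draws without replacement, asymptotically *)

Section InversePowers.
Local Open Scope ring_scope.
Context {R : realType} {T : Type} (D : T -> Prop) (N : T -> nat).
Hypothesis N_gt0 : forall x, D x -> (0 < N x)%N.
Implicit Types (f g : T -> R) (r s m : nat).

(** [f] is O(1/N^r), uniformly over [D]. *)
Definition Oinv r f := exists C : R, forall x, D x -> `|f x| <= C / (N x)%:R ^+ r.

Lemma Oinv_ge0 r f : Oinv r f ->
  exists2 C : R, 0 <= C & forall x, D x -> `|f x| <= C / (N x)%:R ^+ r.
Proof.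
case=> C HC; exists `|C|; first exact: normr_ge0.
move=> x Dx; apply: le_trans (HC x Dx) _.
by rewrite ler_wpM2r ?ler_norm // invr_ge0 exprn_ge0.
Qed.

Lemma Oinv_eq r f g : (forall x, D x -> f x = g x) -> Oinv r g -> Oinv r f.
Proof. by move=> E [C HC]; exists C => x Dx; rewrite E //; apply: HC. Qed.

Lemma OinvD r f g : Oinv r f -> Oinv r g -> Oinv r (fun x => f x + g x).
Proof.
move=> [C HC] [C' HC']; exists (C + C') => x Dx.
by rewrite mulrDl (le_trans (ler_normD _ _)) // lerD ?HC ?HC'.
Qed.

Lemma OinvM r s f g : Oinv r f -> Oinv s g -> Oinv (r + s) (fun x => f x * g x).
Proof.
move=> [C HC] [C' HC']; exists (C * C') => x Dx.
rewrite normrM exprD invfM mulrACA; apply: ler_pM; rewrite ?HC ?HC' //.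
Qed.

Lemma Oinv_cst c : Oinv 0 (fun=> c).
Proof. by exists `|c| => x _; rewrite expr0 divr1. Qed.

Lemma OinvMl c r f : Oinv r f -> Oinv r (fun x => c * f x).
Proof. by move=> H; rewrite -[r]add0n; apply: OinvM H; exact: Oinv_cst. Qed.

Lemma OinvB r f g : Oinv r f -> Oinv r g -> Oinv r (fun x => f x - g x).
Proof.
move=> Hf Hg; apply: Oinv_eq (OinvD Hf (OinvMl (-1) Hg)) => x _.
by rewrite mulN1r.
Qed.

Lemma Oinv_weaken r s f : (s <= r)%N -> Oinv r f -> Oinv s f.
Proof.
move=> le /Oinv_ge0[C C0 HC]; exists C => x Dx; apply: le_trans (HC x Dx) _.
have N1 : 1 <= (N x)%:R :> R by rewrite ler1n N_gt0.
rewrite ler_wpM2l // lef_pV2 ?posrE ?exprn_gt0 ?(lt_le_trans ltr01) //.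
exact: ler_weXn2l.
Qed.

(** Small values of [N] only cost a constant factor. This allows for identities that
    fail where a denominator [N - m] vanishes. *)
Lemma Oinv_eq_large m r f g : (forall x, D x -> (m < N x)%N -> f x = g x) ->
  Oinv 0 f -> Oinv r g -> Oinv r f.
Proof.
move=> E /Oinv_ge0[C0 C0_ge0 H0] /Oinv_ge0[C C_ge0 HC].
exists (C + C0 * m%:R ^+ r) => x Dx.
have Nr0 : 0 < (N x)%:R ^+ r :> R by rewrite exprn_gt0 // ltr0n N_gt0.
case: (ltnP m (N x)) => [lt|le].
  rewrite E // (le_trans (HC x Dx)) // ler_wpM2r ?invr_ge0 ?(ltW Nr0) //.
  by rewrite lerDl mulr_ge0 // exprn_ge0.
rewrite (le_trans (H0 x Dx)) // expr0 divr1 ler_pdivlMr //.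
rewrite -[leLHS]add0r lerD // ler_wpM2l // lerXn2r ?nnegrE // ler_nat //.
Qed.

Lemma OinvMN r f : Oinv r.+1 f -> Oinv r (fun x => (N x)%:R * f x).
Proof.
move=> [C HC]; exists C => x Dx.
have N0 : 0 < (N x)%:R :> R by rewrite ltr0n N_gt0.
by rewrite normrM gtr0_norm // mulrC -ler_pdivlMr // -mulrA -invfM -exprSr HC.
Qed.

(** Unless [N = m], where the inverse is 0, [N] is at most [m + 1] times the distance of [N]
    and [m]. *)
Lemma Oinv_inv m : Oinv 1 (fun x => ((N x)%:R - m%:R)^-1).
Proof.
exists m.+1%:R => x Dx; have N0 := N_gt0 Dx; rewrite expr1.
have [->|neq] := eqVneq (N x) m; first by rewrite subrr invr0 normr0 divr_ge0.
have Nm0 : 0 < `|(N x)%:R - m%:R| :> R by rewrite normr_gt0 subr_eq0 eqr_nat.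
rewrite ler_pdivlMr ?ltr0n // normfV mulrC ler_pdivrMr //.
have -> : `|(N x)%:R - m%:R| = (maxn (N x - m) (m - N x))%:R :> R.
  case: (leqP m (N x)) => le.
    by rewrite -natrB // ger0_norm // (eqP le) maxn0.
  rewrite distrC -natrB ?(ltnW le) // ger0_norm //.
  by rewrite (eqP (ltnW le)) max0n.
rewrite -natrM ler_nat; move: neq; nia.
Qed.

Lemma Oinv_invN : Oinv 1 (fun x => (N x)%:R^-1).
Proof. by apply: Oinv_eq (Oinv_inv 0) => x _; rewrite subr0. Qed.

Lemma Oinv_inv_sub m : Oinv 2 (fun x => ((N x)%:R - m%:R)^-1 - (N x)%:R^-1).
Proof.
have inv0 := Oinv_invN.
apply: (@Oinv_eq_large m _ _ (fun x => m%:R * (((N x)%:R - m%:R)^-1 * (N x)%:R^-1))).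
- move=> x Dx lt; have N0 := N_gt0 Dx; field.
  by rewrite pnatr_eq0 -lt0n N0 subr_eq0 eqr_nat gtn_eqF.
- exact/(Oinv_weaken (leq0n 1))/OinvB/inv0/Oinv_inv.
- apply: OinvMl; apply: (@OinvM 1 1) inv0; exact: Oinv_inv.
Qed.

Lemma Oinv_ratio_sub1 m : Oinv 1 (fun x => (N x)%:R / ((N x)%:R - m%:R) - 1).
Proof.
apply: (@Oinv_eq_large m _ _ (fun x => m%:R * ((N x)%:R - m%:R)^-1)).
- move=> x Dx lt; field.
  by rewrite subr_eq0 eqr_nat gtn_eqF.
- exact: (OinvB (OinvMN (Oinv_inv m)) (Oinv_cst 1)).
- exact/OinvMl/Oinv_inv.
Qed.

End InversePowers.

Section DrawAsymptotics.
Local Open Scope ring_scope.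
Context {R : realType} (D : (nat -> nat) -> Prop) (N : (nat -> nat) -> nat).
Hypothesis N_gt0 : forall n, D n -> (0 < N n)%N.
Hypothesis le_nN : forall n, D n -> forall i, (n i <= N n)%N.

Local Notation O := (@Oinv R _ D N).
Local Notation p n i := ((n i)%:R / (N n)%:R : R).
Local Notation pi n u := (\prod_(i <- u) p n i).

Lemma Oinv_p i : O 0 (fun n => p n i).
Proof.
exists 1 => n Dn; rewrite expr0 divr1 ger0_norm ?divr_ge0 //.
by rewrite ler_pdivrMr ?ltr0n ?N_gt0 // mul1r ler_nat le_nN.
Qed.

Lemma Oinv_pi u : O 0 (fun n => pi n u).
Proof.
elim: u => [|i u IH].
  by apply: Oinv_eq (Oinv_cst _ _ 1) => n _; rewrite big_nil.
by apply: Oinv_eq (OinvM (Oinv_p i) IH) => n _; rewrite big_cons.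
Qed.

Lemma Oinv_draw_factor_sub r i : O 1 (fun n => draw_factor n (N n) r i - p n i).
Proof.
have H1 := OinvM (Oinv_p i) (Oinv_ratio_sub1 N_gt0 (size r)).
have H2 := OinvMl (count_mem i r)%:R (@Oinv_inv R _ _ _ N_gt0 (size r)).
apply: Oinv_eq (OinvB H1 H2) => n Dn; rewrite /draw_factor.
set y := (_ - (size r)%:R)^-1; have N0 : (N n)%:R != 0 :> R by rewrite pnatr_eq0 -lt0n N_gt0.
by field.
Qed.

Lemma Oinv_draw_factor r i : O 0 (fun n => draw_factor n (N n) r i).
Proof.
have H := OinvD (Oinv_weaken N_gt0 (leq0n 1) (Oinv_draw_factor_sub r i)) (Oinv_p i).
by apply: Oinv_eq H => n _; rewrite subrK.
Qed.

Lemma Oinv_draw_sub r u : O 1 (fun n => draw n (N n) r u - pi n u).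
Proof.
elim: u r => [|i u IH] r /=.
  apply: Oinv_eq (OinvMl 0 (@Oinv_inv R _ _ _ N_gt0 0)) => n _.
  by rewrite big_nil subrr mul0r.
have H1 := OinvM (Oinv_draw_factor r i) (IH (rcons r i)).
have H2 := OinvM (Oinv_draw_factor_sub r i) (Oinv_pi u).
by apply: Oinv_eq (OinvD H1 H2) => n _; rewrite big_cons; ring.
Qed.

Lemma Oinv_draw r u : O 0 (fun n => draw n (N n) r u).
Proof.
have H := OinvD (Oinv_weaken N_gt0 (leq0n 1) (Oinv_draw_sub r u)) (Oinv_pi u).
by apply: Oinv_eq H => n _; rewrite subrK.
Qed.

(** With [k = size u], [a = count_mem i u] and [q] the factor before the removal of [u], the factor
    changes by exactly [(k * q - a) / (N - size (u ++ r))] if [N] is large enough; replacing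
    [q] by [p n i] and the denominator by [N] costs O(1/N^2). *)
Lemma Oinv_draw_factor_shift u r i :
  O 2 (fun n => draw_factor n (N n) (u ++ r) i - draw_factor n (N n) r i
        - ((size u)%:R * p n i - (count_mem i u)%:R) / (N n)%:R).
Proof.
set k := size u; set a := count_mem i u.
have bp := Oinv_p i.
have inv0 := @Oinv_invN R _ _ _ N_gt0.
have bc : O 0 (fun n => k%:R * p n i - a%:R) := OinvB (OinvMl _ bp) (Oinv_cst _ _ _).
apply: (@Oinv_eq_large R _ D N N_gt0 (size (u ++ r)) _ _ (fun n =>
  (k%:R * (draw_factor n (N n) r i - p n i)) * ((N n)%:R - (size (u ++ r))%:R)^-1
  + (k%:R * p n i - a%:R) * (((N n)%:R - (size (u ++ r))%:R)^-1 - (N n)%:R^-1))).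
- move=> n Dn; rewrite /draw_factor size_cat count_cat -/k -/a => lt.
  rewrite !natrD; field.
  rewrite pnatr_eq0 -lt0n N_gt0 //= !subr_eq0 -natrD !eqr_nat.
  by apply/andP; split; apply/eqP; lia.
- apply: OinvB; first by apply: OinvB; exact: Oinv_draw_factor.
  exact: (Oinv_weaken N_gt0 (leq0n 1) (OinvM bc inv0)).
- apply: OinvD.
    apply: (@OinvM R _ D N 1 1); first exact/OinvMl/Oinv_draw_factor_sub.
    exact: Oinv_inv.
  apply: (@OinvM R _ D N 0 2) bc _; exact: Oinv_inv_sub.
Qed.

(** [N] times the first-order change of the product of the [q i] over [v] when [u] is drawn
    beforehand: by the product rule, a sum over the letters [i] of [v] in which the factor
    [q i] is replaced by [size u * q i - count_mem i u]. *)
Fixpoint draw_shift (q : nat -> R) (u v : seq nat) : R :=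
  if v is i :: v' then
    ((size u)%:R * q i - (count_mem i u)%:R) * \prod_(j <- v') q j
    + q i * draw_shift q u v'
  else 0.

Lemma Oinv_draw_shift0 u v : O 0 (fun n => draw_shift (fun i => p n i) u v).
Proof.
elim: v => [|i v IH] /=; first exact: Oinv_cst.
apply: OinvD; last exact: (OinvM (Oinv_p i) IH).
exact: (OinvM (OinvB (OinvMl _ (Oinv_p i)) (Oinv_cst D N _)) (Oinv_pi v)).
Qed.

(** Replace the factors one by one; in the term for one letter, all the other
    factors may be replaced by their limits. *)
Lemma Oinv_draw_shift u r v :
  O 2 (fun n => draw n (N n) (u ++ r) v - draw n (N n) r v
                - draw_shift (fun i => p n i) u v / (N n)%:R).
Proof.
elim: v r => [|i v IH] r /=.
  have H := OinvMl 0 (OinvM (@Oinv_inv R _ _ _ N_gt0 0) (@Oinv_inv R _ _ _ N_gt0 0)).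
  by apply: Oinv_eq H => n _; ring.
have inv0 := @Oinv_invN R _ _ _ N_gt0.
have bc : O 0 (fun n => (size u)%:R * p n i - (count_mem i u)%:R)
  := OinvB (OinvMl _ (Oinv_p i)) (Oinv_cst _ _ _).
have H1 := OinvM (Oinv_draw_factor_shift u r i) (Oinv_draw (u ++ rcons r i) v).
have H2 := OinvM (OinvM bc inv0) (Oinv_draw_sub (u ++ rcons r i) v).
have H3 := OinvM (Oinv_draw_factor r i) (IH (rcons r i)).
have H4 := OinvM (Oinv_draw_factor_sub r i) (OinvM (Oinv_draw_shift0 u v) inv0).
apply: Oinv_eq (OinvD (OinvD H1 H2) (OinvD H3 H4)) => n _.
by rewrite rcons_cat; ring.
Qed.

(** When [q i] vanishes, either [i] is not in [u] and its count vanishes, or the product over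
    [u] does; this is why a quotient by 0 does no harm here. *)
Lemma draw_shiftE (q : nat -> R) u v :
  \prod_(i <- u) q i * draw_shift q u v
  = ((size u)%:R * (size v)%:R - \sum_(i <- v) (count_mem i u)%:R / q i)
    * (\prod_(i <- u) q i) * \prod_(i <- v) q i.
Proof.
elim: v => [|i v IH] /=; first by rewrite !big_nil !mulr0 subr0 !mul0r.
rewrite !big_cons mulrDr [X in _ + X]mulrCA IH -[(size v).+1]addn1 natrD.
have E : \prod_(j <- u) q j * (count_mem i u)%:R
    = \prod_(j <- u) q j * ((count_mem i u)%:R / q i * q i).
  have [q0|q0] := eqVneq (q i) 0; last by rewrite divfK.
  rewrite q0 mulr0 mulr0; have [i_u|i_u] := boolP (i \in u).
    by rewrite (big_rem i) //= q0 !mul0r.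
  by rewrite (count_memPn i_u) mulr0.
rewrite mulrA mulrBr E; ring.
Qed.

(** With [A], [B] the probabilities of [u] and [v] and [B'] that of [v] after [u], the
    first two terms are [A * (N * (B' - B) + (1 - size u - size v) * B')]. Here
    [N * (B' - B)] is [draw_shift] up to O(1/N). *)
Lemma Oinv_draw_cov u v :
  O 1 (fun n => ((N n)%:R + 1 - (size u + size v)%:R) * draw n (N n) [::] (u ++ v)
     - (N n)%:R * draw n (N n) [::] u * draw n (N n) [::] v
     - (((size u)%:R - 1) * ((size v)%:R - 1) - \sum_(i <- v) (count_mem i u)%:R / p n i)
       * pi n u * pi n v).
Proof.
have H1 : O 1 (fun n => (N n)%:R * (draw n (N n) u v - draw n (N n) [::] v)
                 - draw_shift (fun i => p n i) u v).
  apply: Oinv_eq (OinvMN N_gt0 (Oinv_draw_shift u [::] v)) => n Dn.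
  by rewrite cats0; field; rewrite pnatr_eq0 -lt0n N_gt0.
pose c : R := 1 - (size u + size v)%:R.
have H2 := OinvMl c (Oinv_draw_sub u v).
have H3 := OinvM (Oinv_draw [::] u) (OinvD H1 H2).
have bshift : O 0 (fun n => draw_shift (fun j => p n j) u v + c * pi n v).
  exact/(OinvD (Oinv_draw_shift0 u v))/OinvMl/Oinv_pi.
have H4 := OinvM (Oinv_draw_sub [::] u) bshift.
apply: Oinv_eq (OinvD H3 H4) => n Dn.
rewrite draw_cat /=.
have := draw_shiftE (fun i => p n i) u v.
rewrite /c natrD.
set S := \sum_(i <- v) _; set d := draw_shift _ u v.
set P := \prod_(i <- u) _; set Q := \prod_(i <- v) _ => E.
have -> : ((size u)%:R - 1) * ((size v)%:R - 1) - S =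
  ((size u)%:R * (size v)%:R - S) + (1 - ((size u)%:R + (size v)%:R)) by ring.
rewrite [X in _ - X * _]mulrDl [X in _ - X]mulrDl -E; ring.
Qed.

End DrawAsymptotics.

(** * The uniform distribution on a finite set of trees *)

Section CountingSeq.
Local Open Scope classical_set_scope.
Local Open Scope ring_scope.

Lemma counting_seq (R : realType) (T : choiceType) (s : seq T) (A : set T) : uniq s ->
  counting (A `&` [set` s]) = (\sum_(x <- s) (x \in A)%:R)%:E :> \bar R.
Proof.
move=> s_uniq.
have finAs : finite_set (A `&` [set` s]) by apply: finite_setIr; exact: finite_seq.
rewrite /counting asboolT //; congr EFin.
rewrite (@perm_size _ _ [seq x <- s | x \in A]); last first.
  apply: uniq_perm; rewrite ?finmap.fset_uniq ?filter_uniq // => x.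
  by rewrite in_fset_set // in_setI mem_filter mem_setE.
rewrite size_filter -sum1_count natr_sum big_mkcond /=.
by apply: eq_bigr => x _; case: ifP.
Qed.

End CountingSeq.

Section UniformTrees.
Local Open Scope classical_set_scope.
Local Open Scope ring_scope.
Context {R : realType} (n : nat -> nat) (L : seq plane_tree).
Hypotheses (L_uniq : uniq L) (L_neq0 : L != [::]) (memL : trees_with n = [set` L]).

Lemma unif_treesE A :
  unif_trees R n A = (((size L)%:R)^-1 * \sum_(t <- L) (t \in A)%:R)%:E.
Proof.
have cntT : counting ([set: plane_tree] `&` trees_with n) = (size L)%:R%:E :> \bar R.
  rewrite memL counting_seq //; congr EFin; rewrite -sum1_size natr_sum.
  by apply: eq_bigr => t _; rewrite in_setT.
rewrite /unif_trees /= /mnormalize /= /mrestr /= cntT.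
rewrite eqe pnatr_eq0 size_eq0 (negbTE L_neq0) /= memL counting_seq //.
by rewrite -EFinM mulrC.
Qed.

Lemma ge0_integral_unif_trees (f : plane_tree -> \bar R) : (forall t, 0 <= f t)%E ->
  (\int[unif_trees R n]_t f t = ((size L)%:R^-1)%:E * \sum_(i < size L) f (nth leaf L i))%E.
Proof.
move=> f0.
have k0 : 0 <= (size L)%:R^-1 :> R by rewrite invr_ge0.
pose k : {nonneg R} := NngNum k0.
rewrite (eq_measure_integral (mscale k (msum (fun i => \d_(nth leaf L i)) (size L)))); last first.
  move=> A _ _; rewrite [LHS]unif_treesE /mscale /= /msum (big_nth leaf) big_mkord EFinM -sumEFin.
  by congr (_ * _)%E; apply: eq_bigr => i _; rewrite diracE.
rewrite ge0_integral_mscale // ge0_integral_measure_sum //; congr (_ * _)%E.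
by apply: eq_bigr => i _; rewrite integral_dirac // diracT mul1e.
Qed.

Lemma expectation_unif_trees (X : plane_tree -> R) :
  'E_(unif_trees R n)[X]%E = ((size L)%:R^-1 * \sum_(t <- L) X t)%:E.
Proof.
rewrite unlock integralE !ge0_integral_unif_trees //.
have Efun (g : plane_tree -> R) (h : plane_tree -> \bar R) : (forall t, h t = (g t)%:E) ->
    \sum_(i < size L) h (nth leaf L i) = (\sum_(t <- L) g t)%:E.
  by move=> E; rewrite (big_nth leaf) big_mkord -sumEFin; apply: eq_bigr => i _; rewrite E.
rewrite (Efun (fun t => Num.max (X t) 0)); last by move=> t; rewrite funeposE EFin_max.
rewrite (Efun (fun t => Num.max (- X t) 0)); last by move=> t; rewrite funenegE EFin_max.
rewrite -!EFinM -EFinB -mulrBr -sumrB; congr (_ * _)%:E; apply: eq_bigr => t _.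
by rewrite /Num.max; case: (ltP (X t)) => ?; case: (ltP (- X t)) => ?; lra.
Qed.

Lemma covariance_unif_trees (X Y : plane_tree -> R) :
  covariance (unif_trees R n) X Y
  = ((size L)%:R^-1 * \sum_(t <- L) X t * Y t
     - ((size L)%:R^-1 * \sum_(t <- L) X t) * ((size L)%:R^-1 * \sum_(t <- L) Y t))%:E.
Proof.
rewrite unlock !expectation_unif_trees /=; congr EFin.
set M := (size L)%:R^-1; set x := M * \sum_(t <- L) X t; set y := M * \sum_(t <- L) Y t.
have M0 : (size L)%:R != 0 :> R by rewrite pnatr_eq0 size_eq0.
transitivity (M * (\sum_(t <- L) X t * Y t - y * (\sum_(t <- L) X t)
    - x * (\sum_(t <- L) Y t) + x * y * (size L)%:R)); last by rewrite /x /y /M; field.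
congr (_ * _); rewrite -[in (size L)%:R]sum1_size natr_sum !mulr_sumr -!sumrB -big_split /=.
apply: eq_bigr => t _; transitivity ((X t - x) * (Y t - y)); first by [].
ring.
Qed.

End UniformTrees.

(** * Moments of fringe subtree counts *)

Section DegreeSums.
Local Open Scope classical_set_scope.
Local Open Scope ring_scope.

(** Iterating [op] over the values [i], each with its multiplicity in [s], is iterating over [s];
    [iterop] specializes to multiples and to powers. *)
Lemma fsbig_count_mem (V : Type) (idx : V) (op : Monoid.com_law idx) (s : seq nat) (g : nat -> V) :
  \big[op/idx]_(i \in [set: nat]) iterop (count_mem i s) op (g i) idx
  = \big[op/idx]_(i <- s) g i.
Proof.
rewrite (fsbigTE (finmap.seq_fset tt s)); last first.
  by move=> i; rewrite finmap.seq_fsetE => /count_memPn ->.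
rewrite -(big_undup_iterop_count op s xpredT g); apply: perm_big.
apply: uniq_perm; rewrite ?finmap.fset_uniq ?undup_uniq // => i.
by rewrite finmap.seq_fsetE mem_undup.
Qed.

Lemma degree_statisticP n : degree_statistic n ->
  exists s : seq nat, [/\ forall i, n i = count_mem i s, size s = nvertices n
    & (sumn s).+1 = size s].
Proof.
case=> fin_n eq_n; pose S := finmap.enum_fset (fset_set [set i | n i != 0%N]).
pose s := flatten [seq nseq (n i) i | i <- S].
have count_s i : n i = count_mem i s.
  rewrite /s count_flatten -map_comp sumnE big_map.
  under eq_bigr => j _ do rewrite /= count_nseq /=.
  have [n0|n0] := eqVneq (n i) 0%N.
    rewrite n0 big1 // => j _; case: eqP => [->|_]; last by rewrite mul0n.
    by rewrite n0 muln0.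
  rewrite (bigD1_seq i) ?finmap.fset_uniq //=; last first.
    by rewrite in_fset_set // mem_setE.
  by rewrite eqxx mul1n big1 ?addn0 // => j /negbTE ->; rewrite mul0n.
have size_s : size s = nvertices n.
  rewrite /nvertices -sum1_size -(fsbig_count_mem _ s (fun=> 1%N)).
  by apply: eq_fsbigr => i _; rewrite count_s -[LHS]/(1%N *+ count_mem i s) natn.
exists s; split => //; rewrite size_s eq_n add1n; congr _.+1.
rewrite sumnE -(fsbig_count_mem _ s id); apply: eq_fsbigr => i _.
by rewrite count_s -[LHS]/(i *+ count_mem i s) -mulr_natr natn.
Qed.

End DegreeSums.

Section TreeFunctionals.
Local Open Scope classical_set_scope.
Local Open Scope ring_scope.
Context {R : realType}.
Implicit Types (p : nat -> R) (t : plane_tree).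

Lemma tree_piE p t : tree_pi p t = \prod_(i <- tree_word t) p i.
Proof.
rewrite /tree_pi -(fsbig_count_mem _ (tree_word t) p).
by apply: eq_fsbigr => i _; rewrite outdeg_countE.
Qed.

Lemma tree_etaE p s t : tree_eta p s t =
  ((tree_size s)%:R - 1) * ((tree_size t)%:R - 1)
  - \sum_(i <- tree_word t) (count_mem i (tree_word s))%:R / p i.
Proof.
rewrite /tree_eta; congr (_ - _).
rewrite -(fsbig_count_mem _ (tree_word t) (fun i => (count_mem i (tree_word s))%:R / p i)).
apply: eq_fsbigr => i _; rewrite !outdeg_countE natrM mulrAC.
by rewrite mulr_natr.
Qed.

(** One formula covers both cases of the definition, because [t] is not a proper fringe
    subtree of itself. *)
Lemma tree_gammaE p s t : tree_gamma p s t =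
  (fringe_count t s)%:R * tree_pi p s
  + ((fringe_count s t)%:R - (s == t)%:R) * tree_pi p t
  + tree_eta p s t * tree_pi p s * tree_pi p t.
Proof.
rewrite /tree_gamma; case: eqP => [<-|_]; last by rewrite subr0.
by rewrite fringe_count_self subrr mul0r addr0 mul1r expr2 mulrA.
Qed.

End TreeFunctionals.

Section Moments.
Local Open Scope classical_set_scope.
Local Open Scope ring_scope.
Context {R : realType} (n : nat -> nat).
Hypothesis n_deg : degree_statistic n.
Let N := nvertices n.

(** [s] is any arrangement of the degrees, and [L] enumerates the trees, of which there are
    finitely many since their words are arrangements of [s]. *)
Lemma trees_with_seq : exists s L, [/\ forall i, n i = count_mem i s, size s = N,
  (sumn s).+1 = size s & [/\ uniq L, trees_with n = [set` L]
    & forall t, (t \in L) = perm_eq (tree_word t) s]].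
Proof.
have [s [count_s size_s sum_s]] := degree_statisticP n_deg.
have ET : trees_with n = tree_word @^-1` [set` permutations s].
  apply/seteqP; split => t /=; rewrite mem_permutations.
    move=> Ht; apply/allP => i _; apply/eqP; rewrite -[LHS]/(count_mem i _).
    by rewrite -outdeg_countE Ht count_s.
  by move=> /permP Ht i; rewrite outdeg_countE Ht count_s.
have /finite_seqP[L0 EL0] : finite_set (trees_with n).
  rewrite ET; apply: finite_preimage; last exact: finite_seq.
  by move=> t t' _ _; exact: tree_word_inj.
exists s, (undup L0); split => //; split; first exact: undup_uniq.
  by rewrite EL0; apply/seteqP; split => t /=; rewrite mem_undup.
move=> t; rewrite mem_undup -mem_permutations.
apply/idP/idP => H.
  have : trees_with n t by rewrite EL0.
  by rewrite ET.
have : trees_with n t by rewrite ET.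
by rewrite EL0.
Qed.

Lemma nvertices_gt0 : (0 < N)%N.
Proof. by rewrite /N (proj2 n_deg). Qed.

Lemma le_nvertices i : (n i <= N)%N.
Proof.
have [s [count_s size_s _]] := degree_statisticP n_deg.
by rewrite count_s /N -size_s count_size.
Qed.

(** The first and second moments under the uniform distribution, before division by the
    number [size L] of trees; these are exact formulas. *)
Lemma trees_with_moments : exists L, [/\ uniq L, L != [::], trees_with n = [set` L],
    forall t, \sum_(x <- L) fringe_countR t x = (size L)%:R * (N%:R * draw n N [::] (tree_word t)) :> R
  & forall t t', \sum_(x <- L) fringe_countR t x * fringe_countR t' x
    = (size L)%:R * (N%:R * ((fringe_count t' t)%:R * draw n N [::] (tree_word t)
    + (N%:R + 1 - (tree_size t + tree_size t')%:R) * draw n N [::] (tree_word t ++ tree_word t')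
    + ((fringe_count t t')%:R - (t == t')%:R) * draw n N [::] (tree_word t'))) :> R].
Proof.
have [s [L [count_s size_s sum_s [uL EL memL]]]] := trees_with_seq.
have inv f K := @sum_trees_invariant s L f K sum_s uL memL.
have Esize : size (permutations s) = (N * size L)%N.
  rewrite -sum1_size (sum_permutations_trees (fun=> 1%N) sum_s uL memL).
  under eq_bigr do rewrite sum1_size size_iota size_s.
  by rewrite big_const_seq count_predT iter_addn_0.
have Edraw u : (prefix_count s u)%:R = (size L)%:R * (N%:R * draw n N [::] u) :> R.
  rewrite (prefix_count_draw (n := n) (N := N) (r := [::])) ?size_s ?addn0 //.
    by rewrite Esize natrM; ring.
  by move=> i; rewrite count_s /= addn0.
exists L; split => // [|t|t t'].
- apply/eqP => L0; have := size_permutations_gt0 s.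
  by rewrite Esize L0 muln0.
- rewrite -Edraw -(inv (cyclic_count (tree_word t)) (prefix_count s (tree_word t))).
  + by rewrite natr_sum; apply: eq_bigr => x _; rewrite -fringe_count_cyclic.
  + by move=> d w; exact: cyclic_count_rot.
  + exact: sum_cyclic_count.
- under eq_bigr do rewrite /fringe_countR -natrM !fringe_count_cyclic.
  rewrite -natr_sum (inv (fun w => cyclic_count _ w * cyclic_count _ w)%N _ _ (sum_cyclic_countM _ _ _));
    last by move=> d w; rewrite !cyclic_count_rot.
  rewrite sum_prefix_cyclic_count !natrD !natrM !Edraw.
  have -> : ((fringe_count t t' - (t == t'))%N)%:R = (fringe_count t t')%:R - (t == t')%:R :> R.
    by rewrite natrB //; case: eqP => // <-; rewrite fringe_count_self.
  (* Where the subtraction is truncated, the words do not fit and both sides vanish. *)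
  have -> : ((size s).+1 - (tree_size t + tree_size t'))%N%:R *
      ((size L)%:R * (N%:R * draw n N [::] (tree_word t ++ tree_word t')))
    = (N%:R + 1 - (tree_size t + tree_size t')%:R) *
      ((size L)%:R * (N%:R * draw n N [::] (tree_word t ++ tree_word t'))) :> R.
    case: (leqP (tree_size t + tree_size t') (size s).+1) => [le|lt].
      by rewrite natrB // -addn1 natrD size_s.
    by rewrite -Edraw prefix_count_eq0 ?mulr0 // size_cat !size_tree_word ltnW.
  ring.
Qed.

End Moments.

Section Asymptotics.
Local Open Scope ring_scope.
Context {R : realType}.

Let N_gt0 n : degree_statistic n -> (0 < nvertices n)%N.
Proof. exact: nvertices_gt0. Qed.

Let le_nN n : degree_statistic n -> forall i, (n i <= nvertices n)%N.
Proof. exact: le_nvertices. Qed.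

Local Notation O := (@Oinv R _ degree_statistic nvertices).

Lemma Oinv_draw_tree_pi t :
  O 1 (fun n => draw n (nvertices n) [::] (tree_word t) - tree_pi (degree_distribution n) t).
Proof.
apply: Oinv_eq (Oinv_draw_sub N_gt0 le_nN [::] (tree_word t)) => n _.
by rewrite tree_piE.
Qed.

Lemma Oinv_bounded f (F : (nat -> nat) -> \bar R) :
  (forall n, degree_statistic n -> F n = (f n)%:E) -> O 0 f ->
  exists C : R, forall n, degree_statistic n -> (`|F n| <= C%:E)%E.
Proof.
move=> E [C HC]; exists C => n n_deg.
by rewrite E // abse_EFin lee_fin; move: (HC n n_deg); rewrite expr0 divr1.
Qed.

Lemma mean_fringe_count_bounded t :
  exists C : R, forall n, degree_statistic n ->
    (`| 'E_(unif_trees R n)[fringe_countR t]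
       - ((nvertices n)%:R * tree_pi (degree_distribution n) t)%:E | <= C%:E)%E.
Proof.
apply: (@Oinv_bounded (fun n => (nvertices n)%:R *
  (draw n (nvertices n) [::] (tree_word t) - tree_pi (degree_distribution n) t))).
  move=> n n_deg; have [L [uL L0 EL E1 _]] := trees_with_moments (R := R) n_deg.
  have M0 : (size L)%:R != 0 :> R by rewrite pnatr_eq0 size_eq0.
  by rewrite (expectation_unif_trees uL L0 EL) E1 mulKf // -EFinB mulrBr.
exact/(OinvMN N_gt0)/Oinv_draw_tree_pi.
Qed.

Lemma covariance_fringe_count_bounded t t' :
  exists C : R, forall n, degree_statistic n ->
    (`| covariance (unif_trees R n) (fringe_countR t) (fringe_countR t')
       - ((nvertices n)%:R * tree_gamma (degree_distribution n) t t')%:E | <= C%:E)%E.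
Proof.
pose u := tree_word t; pose v := tree_word t'.
pose d n w : R := draw n (nvertices n) [::] w.
pose p n : nat -> R := degree_distribution n.
have Hu := OinvMl (fringe_count t' t)%:R (Oinv_draw_tree_pi t).
have Hv := OinvMl ((fringe_count t t')%:R - (t == t')%:R) (Oinv_draw_tree_pi t').
have Huv := Oinv_draw_cov (R := R) N_gt0 le_nN u v.
apply: Oinv_bounded (OinvMN N_gt0 (OinvD (OinvD Hu Hv) Huv)) => n n_deg.
have [L [uL L0 EL E1 E2]] := trees_with_moments (R := R) n_deg.
have M0 : (size L)%:R != 0 :> R by rewrite pnatr_eq0 size_eq0.
rewrite (covariance_unif_trees uL L0 EL) E2 !E1 !mulKf // -EFinB; congr EFin.
rewrite tree_gammaE tree_etaE -!size_tree_word -/u -/v.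
rewrite -(tree_piE (p n) t) -(tree_piE (p n) t').
rewrite -/(p n) /degree_distribution -/(d n u) -/(d n v) -/(d n (u ++ v)); ring.
Qed.

End Asymptotics.

Local Open Scope ring_scope.
Local Open Scope ereal_scope.

Theorem theorem1p6 (R : realType) :
  (forall T : plane_tree,
    (exists C : R, forall n : nat -> nat, degree_statistic n ->
      `| 'E_(unif_trees R n)[fringe_countR T]
         - ((nvertices n)%:R * tree_pi (degree_distribution n) T)%:E | <= C%:E)
    /\
    (exists C : R, forall n : nat -> nat, degree_statistic n ->
      `| 'V_(unif_trees R n)[fringe_countR T]
         - ((nvertices n)%:R * tree_gamma (degree_distribution n) T T)%:E | <= C%:E))
  /\
  (forall T T' : plane_tree,
    exists C : R, forall n : nat -> nat, degree_statistic n ->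
      `| covariance (unif_trees R n) (fringe_countR T) (fringe_countR T')
         - ((nvertices n)%:R * tree_gamma (degree_distribution n) T T')%:E | <= C%:E).
Proof.
split; last exact: covariance_fringe_count_bounded.
move=> T; split; first exact: mean_fringe_count_bounded.
exact: covariance_fringe_count_bounded.
Qed.
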